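(* Let $X,Y$ be $c$-free with respect to $(\varphi,\psi)$ on $\mathbb{C}\langle X,Y\rangle$, $A,B\in M_N(\mathbb{C})$, $\mathbf{\Psi}=(I-z(AX+BY))^{-1}$. With $F_Y=\beta^{\delta,\psi}_Y(Y\mathbf{\Psi})$, $F^\varphi_X=\beta^{\delta,\varphi}_X(X\mathbf{\Psi})$, $F^\varphi_Y=\beta^{\delta,\varphi}_Y(Y\mathbf{\Psi})$, $$\overrightarrow{E}^\varphi_X[\mathbf{\Psi}]=(I-zAF^\varphi_X-zBF^\varphi_Y)^{-1}(I-zAF^\varphi_X-zBF_Y)(I-zAX-zBF_Y)^{-1}.$$
   Context: $X,Y$ $c$-free w.r.t. $(\varphi,\psi)$: $\psi(u_1\cdots u_n)=0$ and $\varphi(u_1\cdots u_n)=\prod\varphi(u_j)$ whenever the $u_j$ alternate between $\mathbb{C}\langle X\rangle$, $\mathbb{C}\langle Y\rangle$ with $\psi(u_j)=0$. Boolean cumulants: $\theta(a_1\cdots a_n)=\sum_k\beta^\theta_k(a_1,\dots,a_k)\theta(a_{k+1}\cdots a_n)$. $\beta^{\delta,\theta}_X(1)=1$, $\beta^{\delta,\theta}_X(Z_1\cdots Z_k)=\beta^\theta_k(Z_1,\dots,Z_k)$ if $Z_1=Z_k=X$, else $0$ (similarly for $Y$). $\beta^{b,\theta}_X(1)=1$ and for a monomial with block factorization $W=U_1\cdots U_n$ (alternating nonempty pure monomials), $\beta^{b,\theta}_X(W)=\beta^\theta_n(U_1,\dots,U_n)$ if $W$ starts and ends with $X$, else $0$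 (similarly $Y$). $\overrightarrow{\delta}_X(W)=\sum_{W=UXV}U\otimes XV$. $E^\psi_X$ is the linear map with $E^\psi_X[X_0]=X_0$ and for $W=X_0Y_1X_1\cdots Y_nX_n$ in block form ($n\ge1$, $X_0,X_n$ possibly $1$) $E^\psi_X[W]=\sum_{p=0}^{n-1}\sum_{0=i_0<i_1<\dots<i_{p+1}=n}X_0X_{i_1}\cdots X_{i_p}X_n\prod_{j=0}^p\beta^\psi_{2(i_{j+1}-i_j)-1}(Y_{i_j+1},X_{i_j+1},\dots,Y_{i_{j+1}})$. $\overrightarrow{E}^\varphi_X:\mathbb{C}\langle X,Y\rangle\to\mathbb{C}\langle X\rangle$ is the linear map defined recursively by: $\overrightarrow{E}^\varphi_X[P(X)]=P(X)$; $\overrightarrow{E}^\varphi_X[P(Y)]=\varphi(P(Y))$; for monomials $W$ starting with $Y$, $\overrightarrow{E}^\varphi_X[W]=\beta^{b,\varphi}_Y(W)+(\beta^{b,\varphi}_Y\otimes\overrightarrow{E}^\varphi_X)[\overrightarrow{\delta}_XW]$; for $W$ starting with $X$, $\overrightarrow{E}^\varphi_X[W]=E^\psi_X[W]+(\beta^{b,\varphi}_X\otimes(\overrightarrow{E}^\varphi_X-E^\psi_X))[\overrightarrow{\delta}_YW]$. All maps act entrywise on matrices and coefficientwise on formal power series in $z$; $\mathbf{\Psi}=\sum_nz^n(AX+BY)^n$ and inverses are formal power series inverses. *)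

(* Defs.v *)
From HB Require Import structures.
From mathcomp Require Import all_boot all_order all_algebra.
Set Implicit Arguments. Unset Strict Implicit. Unset Printing Implicit Defensive.
Import Order.TTheory GRing.Theory Num.Theory.
Local Open Scope ring_scope.

(* Monomials of C<X,Y>: words over {X,Y}, true = X, false = Y. *)
Definition word := seq bool.

Fixpoint blocks (w : word) : seq word :=
  match w with
  | [::] => [::]
  | b :: w' =>
    match blocks w' with
    | bl :: bs => if head (~~ b) bl == b then (b :: bl) :: bs
                  else [:: b] :: bl :: bs
    | [::] => [:: [:: b]]
    end
  end.

(* X_0 Y_1 X_1 ... Y_n X_n parsing: pairs (Y_k, X_k), X_n possibly empty. *)
Fixpoint pairs (bs : seq word) : seq (word * word) :=
  match bs with
  | y :: x :: bs' => (y, x) :: pairs bs'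
  | [:: y] => [:: (y, [::])]
  | [::] => [::]
  end.

Section Defs.
Variable C : numClosedFieldType.

(* Boolean cumulants of a functional theta (given on monomials, extended
   multilinearly), arguments being monomials:
   theta(a_1...a_n) = sum_{k=1}^n beta_k(a_1..a_k) theta(a_{k+1}...a_n).
   Computed by recursion with fuel (fuel = number of arguments). *)
Fixpoint bcum_fuel (theta : word -> C) (fuel : nat) (ws : seq word) : C :=
  match fuel with
  | 0 => 0
  | f.+1 => theta (flatten ws)
            - \sum_(1 <= k < size ws)
                bcum_fuel theta f (take k ws) * theta (flatten (drop k ws))
  end.
Definition bcum (theta : word -> C) (ws : seq word) : C :=
  bcum_fuel theta (size ws) ws.

Definition betaD (L : bool) (theta : word -> C) (w : word) : C :=
  if w is [::] then 1
  else if (head (~~ L) w == L) && (last (~~ L) w == L)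
       then bcum theta [seq [:: b] | b <- w] else 0.

Definition betaB (L : bool) (theta : word -> C) (w : word) : C :=
  if w is [::] then 1
  else if (head (~~ L) w == L) && (last (~~ L) w == L)
       then bcum theta (blocks w) else 0.

(* E^psi_X : C<X,Y> -> C<X> = {poly C} (X |-> 'X), on monomials. *)
Definition EpsiX (psi : word -> C) (w : word) : {poly C} :=
  let x0 := if w is true :: _ then head [::] (blocks w) else [::] in
  let rb := if w is true :: _ then behead (blocks w) else blocks w in
  let pr := pairs rb in
  let n := size pr in
  let Y k := (nth ([::], [::]) pr k.-1).1 in
  let X k := (nth ([::], [::]) pr k.-1).2 in
  let seg a b := flatten [seq [:: Y k; X k] | k <- iota a.+1 (b - a).-1]
                 ++ [:: Y b] in
  if n == 0%N then 'X^(size w) else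
  \sum_(S : {set 'I_n.-1})
    let cs := 0%N :: rcons [seq (nat_of_ord i).+1 | i <- enum S] n in
    (\prod_(ab <- zip cs (behead cs)) bcum psi (seg ab.1 ab.2)) *:
    'X^(size x0 + \sum_(i <- enum S) size (X (nat_of_ord i).+1) + size (X n)).

Fixpoint Earrow_fuel (phi psi : word -> C) (fuel : nat) (w : word)
    : {poly C} :=
  if all (pred1 true) w then 'X^(size w)
  else if all (pred1 false) w then (phi w)%:P
  else match fuel with
  | 0 => 0
  | f.+1 =>
    if head true w == false then
      (betaB false phi w)%:P
      + \sum_(i < size w | nth false w i == true)
          betaB false phi (take i w) *: Earrow_fuel phi psi f (drop i w)
    else
      EpsiX psi w
      + \sum_(i < size w | nth true w i == false)
          betaB true phi (take i w) *:
            (Earrow_fuel phi psi f (drop i w) - EpsiX psi (drop i w))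
  end.
Definition Earrow (phi psi : word -> C) (w : word) : {poly C} :=
  Earrow_fuel phi psi (size w) w.

(* Elements of C<X,Y> as formal finite sums of monomials. *)
Definition ncpoly := seq (C * word).
Definition lin (L : word -> C) (p : ncpoly) : C :=
  \sum_(cw <- p) cw.1 * L cw.2.
Definition ncmul (p q : ncpoly) : ncpoly :=
  [seq (a.1 * b.1, a.2 ++ b.2) | a <- p, b <- q].
Definition ncprod (us : seq ncpoly) : ncpoly := foldr ncmul [:: (1, [::])] us.
Definition pure (L : bool) (p : ncpoly) : bool :=
  all (fun cw => all (pred1 L) cw.2) p.
Definition alternating (us : seq ncpoly) : Prop :=
  exists b : bool, forall j, (j < size us)%N ->
    pure (xorb b (odd j)) (nth [::] us j).

Definition c_free (phi psi : word -> C) : Prop :=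
  forall us : seq ncpoly, (0 < size us)%N -> alternating us ->
    (forall j, (j < size us)%N -> lin psi (nth [::] us j) = 0) ->
    lin psi (ncprod us) = 0 /\
    lin phi (ncprod us) = \prod_(u <- us) lin phi u.

(* Formal power series in z with coefficients in a ring. *)
Definition psmul (R : pzRingType) (f g : nat -> R) : nat -> R :=
  fun n => \sum_(i < n.+1) f i * g (n - i)%N.
Fixpoint pspow (R : pzRingType) (f : nat -> R) (k : nat) : nat -> R :=
  match k with
  | 0 => fun n => if n == 0%N then 1 else 0
  | k'.+1 => psmul f (pspow f k')
  end.
(* formal inverse of a series with constant term 1: sum_k (1 - f)^k *)
Definition psinv (R : pzRingType) (f : nat -> R) : nat -> R :=
  fun n => \sum_(k < n.+1)
             pspow (fun m => (if m == 0%N then 1 else 0) - f m) k n.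

Variable N : nat.
Implicit Types A B : 'M[C]_N.

Definition liftm (M : 'M[C]_N) : 'M[{poly C}]_N := map_mx polyC M.

(* coefficient matrix of the monomial w in (AX+BY)^{|w|} *)
Definition Cw A B (w : word) : 'M[C]_N :=
  \prod_(b <- w) (if b then A else B).

(* coefficients of ->E^phi_X[Psi], Psi = sum_n z^n (AX+BY)^n *)
Definition EPsi (phi psi : word -> C) A B : nat -> 'M[{poly C}]_N :=
  fun n => \sum_(t : n.-tuple bool) Earrow phi psi t *: liftm (Cw A B t).

(* coefficients of beta^{delta,theta}_L(L Psi) *)
Definition Fser (L : bool) (theta : word -> C) A B : nat -> 'M[C]_N :=
  fun n => \sum_(t : n.-tuple bool) betaD L theta (L :: t) *: Cw A B t.

Definition Iminus (A B : 'M[C]_N) (F1 F2 : nat -> 'M[C]_N)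
    : nat -> 'M[{poly C}]_N :=
  fun n => if n is m.+1 then - (liftm A * liftm (F1 m) + liftm B * liftm (F2 m))
           else 1.

Definition IminusX (A B : 'M[C]_N) (F : nat -> 'M[C]_N)
    : nat -> 'M[{poly C}]_N :=
  fun n => if n is m.+1 then
             - ((if m == 0%N then liftm A * ('X)%:M else 0) + liftm B * liftm (F m))
           else 1.

End Defs.

(* Main.v *)
Require Import Defs.
From HB Require Import structures.
From mathcomp Require Import all_boot all_order all_algebra.
From mathcomp Require Import boolp.
Set Implicit Arguments. Unset Strict Implicit. Unset Printing Implicit Defensive.
Import GRing.Theory Num.Theory.
Local Open Scope ring_scope.

(* For c-free X, Y a Boolean phi-cumulant of pure words whose first and last
   arguments come from different algebras vanishes. Cutting phi(w), for w
   starting with L, after its first cumulant, either letter by letter or block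
   by block, therefore gives m_L = d_L (1 + m_L + m_L') = b_L (1 + m_L'), where
   d_L and b_L are the series of beta^delta_L and beta^b_L without constant
   term; hence b_L = d_L (1 + b_L). Write G_X, G_Y (resp. E_X, E_Y) for the
   part of E^psi_X[Psi] (resp. of the arrow expectation) on words starting with
   X, Y. Then G_X = zAX G and G_Y = b^psi_Y (1 + G_X), which yields
   (1 - zAX - d^psi_Y) G = 1; and E_Y = b_Y (1 + E_X),
   E_X - G_X = b_X (E_Y - G_Y) become E_Y = d_Y E and
   E_X - G_X = d_X (E - G), so that
   (1 - d_X - d_Y) E = (1 - d_X - d^psi_Y) G. *)

(** * The ring of formal power series *)

(** The alias carries the ring structure with product [psmul], while staying convertible to the bare
    functions of the theorem. *)
Definition fps (R : pzRingType) : Type := nat -> R.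

Section FpsRing.
Variable R : pzRingType.
Implicit Types f g h : fps R.

HB.instance Definition _ := gen_eqMixin (fps R).
HB.instance Definition _ := gen_choiceMixin (fps R).

Definition fps0 : fps R := fun=> 0.
Definition fps1 : fps R := fun n => if n == 0%N then 1 else 0.
Definition fps_opp f : fps R := fun n => - f n.
Definition fps_add f g : fps R := fun n => f n + g n.

Fact fps_addA : associative fps_add.
Proof. by move=> f g h; apply/funext=> n; rewrite /fps_add addrA. Qed.
Fact fps_addC : commutative fps_add.
Proof. by move=> f g; apply/funext=> n; rewrite /fps_add addrC. Qed.
Fact fps_add0 : left_id fps0 fps_add.
Proof. by move=> f; apply/funext=> n; rewrite /fps_add add0r. Qed.
Fact fps_addN : left_inverse fps0 fps_opp fps_add.
Proof. by move=> f; apply/funext=> n; rewrite /fps_add addNr. Qed.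

HB.instance Definition _ :=
  GRing.isZmodule.Build (fps R) fps_addA fps_addC fps_add0 fps_addN.

Lemma psmul_rev f g n : psmul f g n = \sum_(i < n.+1) f (n - i)%N * g i.
Proof.
rewrite /psmul (reindex_inj rev_ord_inj) /=; apply: eq_bigr => i _.
by rewrite subSS subKn // -ltnS.
Qed.

Fact psmulA : associative (@psmul R).
Proof.
move=> f g h; apply/funext=> n; rewrite [RHS]psmul_rev {1}/psmul.
(* Both sides are the sum of [c j k] over j + k <= n, taken in the two orders of summation. *)
pose c j k := f j * (g (n - j - k)%N * h k).
transitivity (\sum_(j < n.+1) \sum_(k < n.+1 | (k <= n - j)%N) c j k).
  apply: eq_bigr => /= j _; rewrite psmul_rev big_distrr /=.
  by rewrite (big_ord_narrow_leq (leq_subr _ _)).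
rewrite (exchange_big_dep predT) //=; apply: eq_bigr => k _.
transitivity (\sum_(j < n.+1 | (j <= n - k)%N) c j k).
  apply: eq_bigl => j.
  have [lej lek] : (j <= n)%N /\ (k <= n)%N by split; rewrite -ltnS.
  by rewrite /= !leq_subRL // addnC.
rewrite (big_ord_narrow_leq (leq_subr _ _)) /psmul big_distrl /=.
by apply: eq_bigr => j _; rewrite /c -!subnDA addnC mulrA.
Qed.
Fact psmul1l : left_id fps1 (@psmul R).
Proof.
move=> f; apply/funext=> n; rewrite /psmul big_ord_recl big1 ?addr0.
  by rewrite /fps1 mul1r subn0.
by move=> i _; rewrite /fps1 mul0r.
Qed.
Fact psmul1r : right_id fps1 (@psmul R).
Proof.
move=> f; apply/funext=> n; rewrite psmul_rev big_ord_recl big1 ?addr0.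
  by rewrite /fps1 mulr1 subn0.
by move=> i _; rewrite /fps1 mulr0.
Qed.
Fact psmulDl : left_distributive (@psmul R) fps_add.
Proof.
move=> f g h; apply/funext=> n; rewrite /psmul /fps_add -big_split /=.
by apply: eq_bigr => i _; rewrite mulrDl.
Qed.
Fact psmulDr : right_distributive (@psmul R) fps_add.
Proof.
move=> f g h; apply/funext=> n; rewrite /psmul /fps_add -big_split /=.
by apply: eq_bigr => i _; rewrite mulrDr.
Qed.

HB.instance Definition _ := GRing.Zmodule_isPzRing.Build (fps R)
  psmulA psmul1l psmul1r psmulDl psmulDr.

Lemma fpsD f g n : (f + g) n = f n + g n. Proof. by []. Qed.
Lemma fpsN f n : (- f) n = - f n. Proof. by []. Qed.
Lemma fps1E n : (1 : fps R) n = if n == 0%N then 1 else 0. Proof. by []. Qed.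
Lemma fpsME f g : psmul f g = f * g. Proof. by []. Qed.

Lemma pspowE f k : pspow f k = f ^+ k.
Proof. by elim: k => [|k IHk] //; rewrite exprS -IHk. Qed.

Lemma psinvE f n : psinv f n = \sum_(k < n.+1) ((1 - f) ^+ k : fps R) n.
Proof. by apply: eq_bigr => k _; rewrite -pspowE. Qed.

(** Each factor raises the order by at least 1; hence the truncation in [psinv] drops only zeros. *)
Lemma fpsX_small f k n : f 0%N = 0 -> (n < k)%N -> (f ^+ k : fps R) n = 0.
Proof.
move=> f0; elim: k n => // k IHk n ltnk; rewrite exprS -fpsME /psmul.
apply: big1 => -[[|i] /= lti] _; first by rewrite f0 mul0r.
by rewrite IHk ?mulr0 //; case: n lti ltnk => // n _ ltnk;
  rewrite subSS (leq_ltn_trans (leq_subr _ _)).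
Qed.

Lemma psinv_widen f n m : f 0%N = 1 -> (n <= m)%N ->
  psinv f n = \sum_(k < m.+1) ((1 - f) ^+ k : fps R) n.
Proof.
move=> f0 lenm; rewrite psinvE.
have u0 : (1 - f) 0%N = 0 by rewrite fpsD fpsN fps1E f0 subrr.
pose F k := ((1 - f) ^+ k : fps R) n.
rewrite -!(big_mkord xpredT F) [RHS](big_cat_nat (n := n.+1)) //=.
by rewrite [X in _ + X]big_nat_cond [X in _ + X]big1 ?addr0 // => k /andP[/andP[ltnk _] _];
   apply: fpsX_small.
Qed.

(* The geometric series g of 1 - f satisfies g = 1 + g * (1 - f). *)
Lemma psinvVf f : f 0%N = 1 -> (psinv f : fps R) * f = 1.
Proof.
move=> f0; set u : fps R := 1 - f.
suff e : (psinv f : fps R) = 1 + (psinv f : fps R) * u.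
  have {2}-> : f = 1 - u by rewrite /u opprB addrC subrK.
  by rewrite mulrBr mulr1 {1}e addrK.
apply/funext=> n; rewrite fpsD (psinv_widen f0 (leqnSn n)) -/u.
rewrite big_ord_recl expr0; congr (_ + _); rewrite -fpsME /psmul.
transitivity (\sum_(i < n.+1) \sum_(k < n.+1) (u ^+ k : fps R) i * u (n - i)%N).
  rewrite exchange_big /=; apply: eq_bigr => k _.
  by rewrite exprSr -fpsME.
apply: eq_bigr => i _; rewrite (@psinv_widen f i n f0) -1?ltnS //.
by rewrite mulr_suml.
Qed.

Lemma psinv0 f : psinv f 0%N = 1.
Proof. by rewrite psinvE big_ord_recl big_ord0 addr0. Qed.

(** [psinv f] has constant term 1, so it has a left inverse in turn; associativity forces that
    inverse to be [f]. *)
Lemma psinvfV f : f 0%N = 1 -> f * (psinv f : fps R) = 1.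
Proof.
move=> f0; have e := psinvVf (psinv0 f).
suff e' : (psinv (psinv f) : fps R) = f by rewrite -{1}e'.
transitivity ((psinv (psinv f) : fps R) * ((psinv f : fps R) * f)).
  by rewrite psinvVf // mulr1.
by rewrite mulrA e mul1r.
Qed.

End FpsRing.

(** * Splittings of words and their generating series *)

Section Splits.
Variable T : Type.
Implicit Types s : seq T.

Fixpoint splits s : seq (seq T * seq T) :=
  ([::], s) :: if s is x :: s' then [seq (x :: p.1, p.2) | p <- splits s'] else [::].

Lemma splitsE s : splits s = [seq (take i s, drop i s) | i <- iota 0 (size s).+1].
Proof.
elim: s => [//|x s IHs]; rewrite [LHS]/= IHs -map_comp.
have -> : iota 0 (size (x :: s)).+1 = 0%N :: [seq i.+1 | i <- iota 0 (size s).+1].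
  by rewrite [LHS]/= -(iotaDl 1 0).
by rewrite map_cons -[in RHS]map_comp.
Qed.

Lemma splits_rcons s x :
  splits (rcons s x) =
  rcons [seq (p.1, rcons p.2 x) | p <- splits s] (rcons s x, [::]).
Proof. by elim: s => //= y s ->; rewrite map_rcons -!map_comp. Qed.

End Splits.

Lemma splits_map (T U : Type) (h : T -> U) s :
  splits (map h s) = [seq (map h p.1, map h p.2) | p <- splits s].
Proof. by elim: s => //= x s ->; rewrite -!map_comp. Qed.

Lemma mem_splits (T : eqType) (s : seq T) p : p \in splits s -> p.1 ++ p.2 = s.
Proof.
elim: s p => [|x s IHs] p /=; first by rewrite inE => /eqP->.
by rewrite inE => /predU1P[->|/mapP[q /IHs <- ->]].
Qed.

Fixpoint words (n : nat) : seq word :=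
  if n is n'.+1 then [seq true :: w | w <- words n'] ++ [seq false :: w | w <- words n']
  else [:: [::]].

Lemma big_words (V : nmodType) n (F : word -> V) :
  \sum_(t : n.-tuple bool) F t = \sum_(w <- words n) F w.
Proof.
elim: n F => [|n IHn] F.
  by rewrite (big_pred1 [tuple]) ?big_seq1 // => t; apply/esym/eqP; apply: tuple0.
rewrite /= big_cat !big_map -!IHn.
rewrite (reindex (fun p : bool * n.-tuple bool => [tuple of p.1 :: p.2])) /=.
  by rewrite -(pair_bigA _ (fun b (t : n.-tuple bool) => F (b :: t))) /= big_bool.
exists (fun t : n.+1.-tuple bool => (thead t, [tuple of behead t])) => [[b t]|t] _ /=.
  by congr (_, _); apply: val_inj.
by rewrite -tuple_eta.
Qed.

(** Two words of lengths i and n - i amount to a word of length n with a marked cut; this turns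
    Cauchy products into [conv]. *)
Lemma big_words_splits (V : nmodType) n (H : word -> word -> V) :
  \sum_(i < n.+1) \sum_(u <- words i) \sum_(v <- words (n - i)) H u v =
  \sum_(w <- words n) \sum_(p <- splits w) H p.1 p.2.
Proof.
elim: n H => [|n IHn] H.
  by rewrite big_ord_recl big_ord0 addr0 /= !big_seq1.
rewrite big_ord_recl subn0 [words (val ord0)]/= big_seq1 /= !big_cat !big_map /=.
transitivity (\sum_(w <- words n) (H [::] (true :: w)) +
  \sum_(w <- words n) (H [::] (false :: w)) +
  (\sum_(i < n.+1) \sum_(u <- words i) \sum_(v <- words (n - i)) H (true :: u) v +
  \sum_(i < n.+1) \sum_(u <- words i) \sum_(v <- words (n - i)) H (false :: u) v)).
  congr (_ + _); rewrite -big_split /=; apply: eq_bigr => i _.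
  by rewrite big_cat !big_map /=.
rewrite !IHn addrACA; congr (_ + _); rewrite -big_split /=;
  by apply: eq_bigr => w _; rewrite big_cons big_map.
Qed.

(** * Generating series of weights on words *)

Section Ser.
Variables (C : numClosedFieldType) (N : nat) (A B : 'M[C]_N).
Implicit Types f g : word -> {poly C}.

(** Weights lie in [{poly C}], the model of C<X>, so that scalar cumulants and conditional
    expectations share one ring. *)
Definition ser f : fps 'M[{poly C}]_N :=
  fun n => \sum_(w <- words n) f w *: liftm (Cw A B w).

Definition conv f g : word -> {poly C} :=
  fun w => \sum_(p <- splits w) f p.1 * g p.2.

Lemma liftmM (M M' : 'M[C]_N) : liftm (M * M') = liftm M * liftm M'.
Proof. exact: map_mxM. Qed.

Lemma liftm1 : liftm (1 : 'M[C]_N) = 1.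
Proof. exact: map_mx1. Qed.

Lemma scalemxM (a b : {poly C}) (M M' : 'M[{poly C}]_N) :
  (a * b) *: (M * M') = (a *: M) * (b *: M').
Proof.
by rewrite -!mulmxE -scalemxAl -scalemxAr scalerA.
Qed.

Lemma Cw_cat u v : Cw A B (u ++ v) = Cw A B u * Cw A B v.
Proof. by rewrite /Cw big_cat. Qed.

Lemma serM f g : ser f * ser g = ser (conv f g).
Proof.
apply/funext=> n; rewrite -fpsME /psmul /ser.
transitivity (\sum_(w <- words n) \sum_(p <- splits w)
    (f p.1 * g p.2) *: liftm (Cw A B (p.1 ++ p.2))); last first.
  apply: eq_bigr => w _; rewrite /conv scaler_suml big_seq [RHS]big_seq.
  by apply: eq_bigr => p /mem_splits ->.
rewrite -(big_words_splits n (fun u v => (f u * g v) *: liftm (Cw A B (u ++ v)))).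
apply: eq_bigr => i _; rewrite mulr_suml; apply: eq_bigr => u _.
rewrite mulr_sumr; apply: eq_bigr => v _.
by rewrite Cw_cat liftmM scalemxM.
Qed.

Lemma serD f g : ser f + ser g = ser (fun w => f w + g w).
Proof.
apply/funext=> n; rewrite fpsD /ser -big_split /=.
by apply: eq_bigr => w _; rewrite scalerDl.
Qed.

Lemma serB f g : ser f - ser g = ser (fun w => f w - g w).
Proof.
apply/funext=> n; rewrite fpsD fpsN /ser -sumrN -big_split /=.
by apply: eq_bigr => w _; rewrite scalerBl.
Qed.

Lemma ser1 : ser (fun w => (nilp w)%:R) = 1.
Proof.
apply/funext=> -[|n]; rewrite fps1E /ser.
  by rewrite big_seq1 /= scale1r /Cw big_nil liftm1.
by rewrite big_cat /= !big_map !big1 ?addr0 // => w _; rewrite scale0r.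
Qed.

Lemma eq_ser f g : f =1 g -> ser f = ser g.
Proof. by move=> /funext->. Qed.

End Ser.

(** * Vanishing of mixed Boolean cumulants *)

Section Bcum.
Variable C : numClosedFieldType.
Implicit Types (theta phi psi S : word -> C) (p q u y : ncpoly C) (us : seq (ncpoly C)).

(* The empty list must be excluded: [bcum_fuel theta f.+1 [::]] is
   [theta [::]], whereas [bcum theta [::] = 0]. *)
Lemma bcum_fuelE theta f ws : ws != [::] -> (size ws <= f)%N ->
  bcum_fuel theta f ws = bcum theta ws.
Proof.
suff E : forall f f' ws, ws != [::] -> (size ws <= f)%N -> (size ws <= f')%N ->
    bcum_fuel theta f ws = bcum_fuel theta f' ws by move=> *; apply: E.
move=> {f ws}; elim=> [|f IHf] [|f'] [|a ws] //= _ lef lef'; congr (_ - _).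
rewrite !big_nat; apply: eq_bigr => -[//|k] /andP[_ ltk] /=; congr (_ * _).
have szk : (size (take k ws) <= k)%N by rewrite size_take_min geq_minl.
apply: IHf => //=; first exact: leq_ltn_trans szk (leq_trans ltk lef).
exact: leq_ltn_trans szk (leq_trans ltk lef').
Qed.

(** All cuts may be summed: the empty prefix contributes [bcum theta [::] = 0], and the full one the
    cumulant itself, since [theta [::] = 1]. *)
Lemma bcum_recursion theta ws : theta [::] = 1 -> ws != [::] ->
  theta (flatten ws) =
  \sum_(s <- splits ws) bcum theta s.1 * theta (flatten s.2).
Proof.
move=> theta1 ws0; rewrite splitsE big_map /= -/(iota _ _.+1).
rewrite -[iota 0 _]/(index_iota 0 (size ws).+1) big_nat_recl //=.
rewrite take0 mul0r add0r; case: ws ws0 => // a ws _.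
rewrite -(big_add1 _ _ 0 (size (a :: ws)).+1 xpredT
  (fun i => bcum theta (take i (a :: ws)) * theta (flatten (drop i (a :: ws))))).
rewrite big_nat_recr //= take_size drop_size theta1 mulr1.
suff -> : bcum theta (a :: ws) = theta (flatten (a :: ws)) -
    \sum_(1 <= k < size (a :: ws))
      bcum theta (take k (a :: ws)) * theta (flatten (drop k (a :: ws))).
  by rewrite addrC subrK.
rewrite {1}/bcum -[size _]/(size ws).+1 [LHS]/=; congr (_ - _).
rewrite !big_nat; apply: eq_bigr => -[//|k] /andP[_ ltk].
congr (_ * _); rewrite bcum_fuelE //= size_take_min.
by rewrite (leq_ltn_trans (geq_minl _ _)).
Qed.

Lemma lin_cons S a p : lin S (a :: p) = a.1 * S a.2 + lin S p.
Proof. exact: big_cons. Qed.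

Lemma lin1 S : lin S [:: (1, [::])] = S [::].
Proof. by rewrite lin_cons mul1r /lin big_nil addr0. Qed.

Lemma lin_lincomb S S' k p :
  lin (fun w => S w - k * S' w) p = lin S p - k * lin S' p.
Proof.
rewrite /lin mulr_sumr -sumrB; apply: eq_bigr => a _.
by rewrite mulrBr mulrCA.
Qed.

Lemma lin_ncmul S p q :
  lin S (ncmul p q) = \sum_(a <- p) a.1 * lin (fun w => S (a.2 ++ w)) q.
Proof.
rewrite /lin /ncmul big_allpairs_dep; apply: eq_bigr => a _.
by rewrite mulr_sumr; apply: eq_bigr => b _ /=; rewrite mulrA.
Qed.

Definition shift (a : word) p : ncpoly C := [seq (c.1, a ++ c.2) | c <- p].

Lemma lin_shift S a p us :
  lin (fun w => S (a ++ w)) (ncprod (p :: us)) = lin S (ncprod (shift a p :: us)).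
Proof.
rewrite /= !lin_ncmul big_map; apply: eq_bigr => b _ /=.
by congr (_ * lin _ _); apply/funext => w; rewrite catA.
Qed.

Lemma lin_shift1 S a us :
  lin (fun w => S (a ++ w)) (ncprod us) = lin S (ncprod ([:: (1, a)] :: us)).
Proof. by rewrite /= lin_ncmul big_seq1 mul1r. Qed.

(** The element p - psi(p). The empty word is pure in both letters, so centering preserves
    purity. *)
Definition center psi p : ncpoly C := (- lin psi p, [::]) :: p.

Lemma lin_center psi p : psi [::] = 1 -> lin psi (center psi p) = 0.
Proof. by move=> psi1; rewrite lin_cons psi1 mulr1 addNr. Qed.

Lemma lin_center_cons psi S p us :
  lin S (ncprod (center psi p :: us)) =
  lin S (ncprod (p :: us)) - lin psi p * lin S (ncprod us).
Proof. by rewrite /= !lin_ncmul big_cons addrC mulNr. Qed.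

Lemma lin_center_rcons psi S us y :
  lin S (ncprod (rcons us (center psi y))) =
  lin S (ncprod (rcons us y)) - lin psi y * lin S (ncprod us).
Proof.
elim: us S => [|u us IHus] S; first exact: lin_center_cons.
rewrite !rcons_cons [ncprod (u :: _)]/= [ncprod (u :: rcons us y)]/= [ncprod (u :: us)]/=.
rewrite !lin_ncmul mulr_sumr -sumrB; apply: eq_bigr => a _.
by rewrite IHus mulrBr mulrCA.
Qed.

(* [e] is the letter that a further factor at the end would have. *)
Fixpoint centered_alt psi (b e : bool) us : Prop :=
  if us is u :: us' then [/\ pure b u, lin psi u = 0 & centered_alt psi (~~ b) e us']
  else b = e.

Lemma centered_alt_nth psi b e us : centered_alt psi b e us ->
  forall j, (j < size us)%N ->
    pure (xorb b (odd j)) (nth [::] us j) /\ lin psi (nth [::] us j) = 0.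
Proof.
elim: us b => [//|u us IHus] b /= [pu u0 /IHus H] [_|j ltj].
  by rewrite /= ; case: (b) pu.
by have := H j ltj; rewrite /=; case: (b) (odd j) => -[].
Qed.

Lemma centered_alt_rcons psi b e us y : centered_alt psi b e us ->
  pure e y -> lin psi y = 0 -> centered_alt psi b (~~ e) (rcons us y).
Proof.
move=> + py y0; elim: us b => [|u us IHus] b /= => [->|[pu u0 /IHus]] //.
Qed.

Lemma pure_shift b a p : all (pred1 b) a -> pure b p -> pure b (shift a p).
Proof.
move=> pa pp; rewrite /pure /shift all_map.
by apply: sub_all pp => c /=; rewrite all_cat pa.
Qed.

(** * c-freeness as a splitting rule for the last factor *)

Section Vanishing.
Variables (phi psi : word -> C).
Hypotheses (phi1 : phi [::] = 1) (psi1 : psi [::] = 1).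
Hypothesis hcfree : c_free phi psi.

Lemma c_free_prod b e us : centered_alt psi b e us ->
  lin phi (ncprod us) = \prod_(u <- us) lin phi u.
Proof.
case: us => [_|u us /centered_alt_nth H]; first by rewrite big_nil lin1.
have [||j /H[]//|//] := hcfree (us := u :: us) => //.
by exists b => j /H[].
Qed.

(* The invariant behind the vanishing of mixed cumulants: it survives left
   translations of [S], see [split_right_shift]. *)
Definition split_right S e := forall b us y, centered_alt psi b e us -> pure e y ->
  lin S (ncprod (rcons us y)) = lin S (ncprod us) * lin phi y.

(** Apply c-freeness with y - psi(y) as last factor; the terms psi(y) phi(us) cancel on both
    sides. *)
Lemma split_right_phi e : split_right phi e.
Proof.
move=> b us y cus py.
have pcy : pure e (center psi y) by [].
have := c_free_prod (centered_alt_rcons cus pcy (lin_center _ psi1)).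
rewrite lin_center_rcons big_rcons /= -(c_free_prod cus).
by rewrite lin_cons phi1 mulr1 mulrDr mulrN [_ * lin psi y]mulrC [RHS]addrC => /addIr.
Qed.

Section Step.
Variables (S : word -> C) (e : bool).
Hypothesis splitS : split_right S e.

(** The first factor need not be centered: write p = (p - psi(p)) + psi(p) and split both
    [center psi p :: us] and [us]. *)
Lemma split_right_cons c p us y : pure c p -> centered_alt psi (~~ c) e us ->
  pure e y ->
  lin S (ncprod (p :: rcons us y)) = lin S (ncprod (p :: us)) * lin phi y.
Proof.
move=> pp cus py.
have ccp : centered_alt psi c e (center psi p :: us) by split=> //; apply: lin_center.
have := splitS ccp py; rewrite rcons_cons !lin_center_cons (splitS cus py).
by rewrite mulrBl mulrA => /addIr.
Qed.

(** If [us] starts in the other algebra, [a] becomes a new first factor; otherwise it is absorbed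
    into the first factor. With [us] empty and [a], [y] in the same algebra, both sides vanish
    because [S [::] = 0] makes [S] vanish on that algebra. *)
Lemma split_right_shift c a : all (pred1 c) a -> S [::] = 0 \/ c = ~~ e ->
  split_right (fun w => S (a ++ w)) e.
Proof.
move=> pa hS b us y cus py.
have pa1 : pure c [:: (1 : C, a)] by rewrite /pure /= pa.
have [cb|] := eqVneq b (~~ c).
  by rewrite !lin_shift1 (split_right_cons pa1 _ py) // -cb.
move=> nb; have eb : b = c by move: nb; case: (b); case: (c).
case: us cus => [|u us]; rewrite eb; [move=> ce|case=> pu _ cus].
  rewrite /= in ce; case: hS => [S0|]; last by rewrite ce; case: (e).
  have S1 z : pure e z -> lin S (ncprod [:: z]) = 0.
    by move=> pz; rewrite (splitS (b := e) (us := [::])) // lin1 S0 mul0r.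
  by rewrite lin_shift lin_shift1 !S1 ?mul0r // -?ce // pure_shift // ce.
by rewrite rcons_cons !lin_shift (split_right_cons _ cus py) ?pure_shift.
Qed.

End Step.

Definition mono (w : word) := all (pred1 (head true w)) w.

(* As a function of w this is phi ((v - phi v) w), where v is a_1 for the list
   a_1 and (v' - phi v') a_n for the list a_1, ..., a_n, v' belonging to
   a_1, ..., a_(n-1); moreover phi v is the Boolean cumulant of the list. *)
Definition residue (ws : seq word) : word -> C := fun w =>
  phi (flatten ws ++ w) - \sum_(s <- splits ws) bcum phi s.1 * phi (flatten s.2 ++ w).

Lemma residue_nil w : residue [::] w = phi w.
Proof. by rewrite /residue big_seq1 mul0r subr0. Qed.

Lemma residue0 ws : ws != [::] -> residue ws [::] = 0.
Proof.
move=> ws0; rewrite /residue cats0 (bcum_recursion phi1 ws0) -sumrB big1 // => s _.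
by rewrite cats0 subrr.
Qed.

Lemma residue_rcons ws a w :
  residue (rcons ws a) w = residue ws (a ++ w) - bcum phi (rcons ws a) * phi w.
Proof.
rewrite /residue splits_rcons big_rcons big_map /=.
rewrite flatten_rcons -catA opprD addrA; congr (_ - _ - _).
by apply: eq_bigr => s _; rewrite flatten_rcons catA.
Qed.

(** The residue of the longer list vanishes at the empty word; expanding it by [residue_rcons]
    isolates the cumulant. *)
Lemma bcum_rcons ws a : bcum phi (rcons ws a) = residue ws a.
Proof.
have : residue (rcons ws a) [::] = 0 by apply: residue0; case: (ws).
by rewrite residue_rcons cats0 phi1 mulr1 => /eqP; rewrite subr_eq0 => /eqP.
Qed.

(** Appending [a] translates the residue by [a] and subtracts a multiple of [phi]; both operations
    keep the splitting. The translation is allowed because the residue of a nonempty list vanishes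
    at the empty word, while a first argument has letter [L], opposite to that of y. *)
Lemma split_right_residue L ws : all mono ws -> all (pred1 L) (head [::] ws) ->
  split_right (residue ws) (~~ L).
Proof.
elim/last_ind: ws => [_ _|ws a IHws].
  by rewrite (funext residue_nil); apply: split_right_phi.
rewrite all_rcons => /andP[ma mws] hL.
have splitws : split_right (residue ws) (~~ L).
  by apply: IHws => //; case: (ws) hL.
have [c pa hc] : exists2 c, all (pred1 c) a & residue ws [::] = 0 \/ c = ~~ ~~ L.
  case: (eqVneq ws [::]) hL => [-> /= ha|ws0 _].
    by exists L => //; right; rewrite negbK.
  by exists (head true a) => //; left; apply: residue0.
have sh := split_right_shift splitws pa hc.
rewrite (funext (residue_rcons ws a)) => b us y cus py.
by rewrite !lin_lincomb (sh _ _ _ cus py) (split_right_phi cus py) mulrBl mulrA.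
Qed.

(** The cumulant is the residue of the preceding arguments at the last one [a]; splitting off [a]
    leaves the factor [residue ws [::] = 0]. *)
Lemma bcum_vanish L ws : all mono ws -> all (pred1 L) (head [::] ws) ->
  all (pred1 (~~ L)) (last [::] ws) -> head [::] ws != [::] -> last [::] ws != [::] ->
  bcum phi ws = 0.
Proof.
case/lastP: ws => [//|ws a]; rewrite all_rcons last_rcons => /andP[ma mws] hL la h0 l0.
have ws0 : ws != [::].
  case: (ws) hL h0 => //= hL _; case: (a) l0 hL la => //= x s _ /andP[/eqP-> _].
  by case: (L).
have hL' : all (pred1 L) (head [::] ws) by case: (ws) ws0 hL.
have pa : pure (~~ L) [:: (1 : C, a)] by rewrite /pure /= la.
have := split_right_residue mws hL' (us := [::]) (erefl _) pa.
rewrite /= lin_ncmul big_seq1 lin1 mul1r /= cats0 lin1 residue0 // mul0r.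
by rewrite bcum_rcons.
Qed.

End Vanishing.

(** The product of the centered values is 0, so freeness for [psi] is c-freeness of the pair (psi,
    psi); results on [phi] thus apply to [psi]. *)
Lemma c_free_diag phi psi : c_free phi psi -> c_free psi psi.
Proof.
move=> hcf us us0 alt cen; have [h _] := hcf us us0 alt cen; split=> //.
rewrite h; case: us us0 cen {alt h} => // u us _ /(_ 0%N isT) /= u0.
by rewrite big_cons u0 mul0r.
Qed.

End Bcum.

(** * Block and letter cumulant series *)

Definition cons_block (b : bool) (bs : seq word) : seq word :=
  if bs is bl :: bs' then
    if head (~~ b) bl == b then (b :: bl) :: bs' else [:: b] :: bl :: bs'
  else [:: [:: b]].

Lemma blocks_cons b w : blocks (b :: w) = cons_block b (blocks w).
Proof. by []. Qed.

Arguments blocks : simpl never.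

Lemma blocks_head b w : exists bl bs, blocks (b :: w) = (b :: bl) :: bs.
Proof.
rewrite blocks_cons; case: (blocks w) => [|bl bs] /=; first by exists [::], [::].
by case: eqP => _; do 2!eexists.
Qed.

Lemma flatten_blocks w : flatten (blocks w) = w.
Proof.
elim: w => // b w IHw; rewrite blocks_cons -[in RHS]IHw.
by case: (blocks w) => [|bl bs] //=; case: ifP.
Qed.

Lemma mono_blocks w : all mono (blocks w).
Proof.
elim: w => // b w; rewrite blocks_cons; case: (blocks w) => [|bl bs] /=.
  by rewrite /mono /= eqxx.
case/andP=> mbl mbs; case: ifP => [/eqP hb|_] /=; rewrite mbs andbT /mono /= ?eqxx //=.
by case: (bl) hb mbl => [|c s] //= ->.
Qed.

Lemma last_blocks b w :
  last [::] (blocks (b :: w)) = nseq (size (last [::] (blocks (b :: w)))) (last b w)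
  /\ last [::] (blocks (b :: w)) != [::].
Proof.
elim: w b => [//|c w IHw] b; rewrite blocks_cons.
have [bl [bs e]] := blocks_head c w; have [] := IHw c; rewrite e /=.
have [<-|//] := eqVneq c b; move: (last c w) => l.
case: (bs) => [[-> h] _|b' bs' h1 h2]; last by [].
by split=> //=; rewrite [LHS]/= -[RHS]/[:: l, l & nseq (size bl) l] -h.
Qed.

Definition boundary (p : word * word) :=
  [|| nilp p.1, nilp p.2 | last true p.1 != head true p.2].

Arguments boundary : simpl never.

(** Cuts that fall between blocks are, in order, the cuts of the list of blocks; block cumulants
    thereby become convolutions over words. *)
Lemma splits_blocks w :
  [seq (blocks p.1, blocks p.2) | p <- splits w & boundary p] = splits (blocks w).
Proof.
elim: w => [//|b [|c w] IHw]; first by [].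
have [bl [bs e]] := blocks_head c w.
rewrite (blocks_cons b) e; rewrite e in IHw.
(* [R] lists the cuts of [c :: w] other than the one at the front. *)
pose R := [seq (c :: p.1, p.2) | p <- splits w].
have {}IHw : [seq (blocks p.1, blocks p.2) | p <- R & boundary p] =
    [seq ((c :: bl) :: p.1, p.2) | p <- splits bs] by case: IHw.
have eR : [seq (blocks p.1, blocks p.2) | p <- [seq (b :: p.1, p.2) | p <- R] & boundary p]
   = [seq (cons_block b q.1, q.2) | q <- [seq ((c :: bl) :: p.1, p.2) | p <- splits bs]].
  rewrite -IHw -map_comp filter_map -map_comp /R !filter_map -!map_comp.
  by apply: eq_map.
rewrite -[splits _]/(([::], [:: b, c & w]) :: ([:: b], c :: w) :: [seq (b :: p.1, p.2) | p <- R]).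
have b1 : boundary ([:: b], c :: w) = (b != c) by [].

rewrite [filter _ _]/= b1 [LHS]/= (blocks_cons b) e [cons_block _ _]/=.
(* If [b = c], the cut between them is lost and [b] joins the first block; otherwise the cut
   survives and [b] is a block of its own. *)
have [ebc|nbc] := eqVneq b c.
  rewrite eR ebc; congr (_ :: _).
  by rewrite -map_comp; apply: eq_map => p /=; rewrite eqxx.
rewrite map_cons eR e [RHS]/=.
congr [:: _, _ & _]; rewrite -!map_comp; apply: eq_map => p /=.
by rewrite eq_sym (negPf nbc).
Qed.

Lemma big_splits_blocks (V : nmodType) w (F : seq word * seq word -> V) :
  \sum_(p <- splits w | boundary p) F (blocks p.1, blocks p.2) =
  \sum_(q <- splits (blocks w)) F q.
Proof. by rewrite -splits_blocks big_map big_filter. Qed.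

Lemma flatten_letters (w : word) : flatten [seq [:: b] | b <- w] = w.
Proof. by elim: w => //= b w ->. Qed.

Lemma mono_letters (w : word) : all mono [seq [:: b] | b <- w].
Proof. by elim: w => //= b w ->; rewrite /mono /= eqxx. Qed.

Section Identities.
Variables (C : numClosedFieldType) (phi psi : word -> C).
Hypotheses (phi1 : phi [::] = 1) (psi1 : psi [::] = 1).
Hypothesis hcfree : c_free phi psi.
Implicit Types (L : bool) (f : word -> {poly C}).

Lemma bcum_letters_vanish L b w : b = L -> last b w != L ->
  bcum phi [seq [:: b] | b <- b :: w] = 0.
Proof.
move=> -> lw; have m := mono_letters (L :: w).
have el : last [::] [seq [:: b] | b <- L :: w] = [:: last L w].
  exact: (last_map (fun b => [:: b]) w L).
apply: (bcum_vanish phi1 psi1 hcfree (L := L)) => //; rewrite ?el //=.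
  by rewrite eqxx.
by move: lw; case: (last L w); case: (L).
Qed.

Lemma bcum_blocks_vanish L b w : b = L -> last b w != L ->
  bcum phi (blocks (b :: w)) = 0.
Proof.
move=> eb lw; have [bl [bs e]] := blocks_head b w.
have [elast nlast] := last_blocks b w.
have m := mono_blocks (b :: w).
apply: (bcum_vanish phi1 psi1 hcfree (L := L)) => //; last by rewrite e.
  by move: m; rewrite e eb /= => /andP[].
rewrite elast all_nseq; apply/orP; right.
by move: lw; rewrite eb /=; case: (last L w); case: (L).
Qed.

Definition startsWith L f : word -> {poly C} :=
  fun w => if head (~~ L) w == L then f w else 0.
Definition positivePart f : word -> {poly C} :=
  fun w => if w is [::] then 0 else f w.
Definition cst (g : word -> C) : word -> {poly C} := fun w => (g w)%:P.
Definition unitOr f : word -> {poly C} := fun w => (nilp w)%:R + f w.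

(** The cumulant recursion letter by letter: prefixes ending in the other letter, which [betaD] sets
    to 0, have vanishing mixed cumulants. *)
Lemma startsWith_letters L :
  startsWith L (cst phi) =1 conv (positivePart (cst (betaD L phi))) (cst phi).
Proof.
move=> w; rewrite /startsWith /conv; case: eqP => [hw|hw]; last first.
  rewrite big_seq big1 // => -[[|b u] v] /mem_splits /= e; first by rewrite mul0r.
  by rewrite /cst /betaD /= -e in hw *; case: eqP => // _; rewrite mul0r.
have w0 : [seq [:: b] | b <- w] != [::] by case: (w) hw => //=; case: (L).
rewrite /cst -{1}(flatten_letters w) (bcum_recursion phi1 w0) splits_map big_map.
rewrite rmorph_sum big_seq [RHS]big_seq; apply: eq_bigr => -[[|b u] v] /mem_splits /= e.
  by rewrite !mul0r.
rewrite rmorphM flatten_letters /=; congr (_%:P * _).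
rewrite -e /= in hw; rewrite hw eqxx /=; case: ifPn => // lu.
by rewrite -(bcum_letters_vanish _ lu).
Qed.

Lemma bcum_blocks_recursion theta w : theta [::] = 1 -> w != [::] ->
  theta w = \sum_(p <- splits w | boundary p) bcum theta (blocks p.1) * theta p.2 :> C.
Proof.
move=> theta1 w0; rewrite -{1}(flatten_blocks w) bcum_recursion //; last first.
  by case: (w) w0 => // b s _; have [? [? ->]] := blocks_head b s.
rewrite -big_splits_blocks; apply: eq_bigr => p _.
by rewrite flatten_blocks.
Qed.

(** After a prefix ending in [L], a cut is a block boundary exactly when the rest is empty or starts
    with the other letter. Boundary prefixes ending in the other letter have vanishing mixed
    cumulants. *)
Lemma startsWith_blocks L :
  startsWith L (cst phi) =1
  conv (positivePart (cst (betaB L phi))) (unitOr (startsWith (~~ L) (cst phi))).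
Proof.
move=> w; rewrite {1}/startsWith /conv; case: eqP => [hw|hw]; last first.
  rewrite big_seq big1 // => -[[|b u] v] /mem_splits /= e; first by rewrite mul0r.
  by rewrite /cst /betaB /= -e in hw *; case: eqP => // _; rewrite mul0r.
have w0 : w != [::] by case: (w) hw => //=; case: (L).
rewrite /cst (bcum_blocks_recursion phi1 w0) rmorph_sum big_mkcond.
rewrite big_seq [RHS]big_seq; apply: eq_bigr => -[[|b u] v] /mem_splits /= e.
  by rewrite !mul0r.
rewrite -e /= in hw; rewrite hw eqxx /boundary /=; have [lu|lu] := eqVneq (last L u) L.
  case: v {e} => [|c v]; rewrite /unitOr /startsWith /= ?negbK ?lu.
    by rewrite phi1 mulr1; case: (L); rewrite /= addr0 mulr1.
  by rewrite add0r; case: (c); case: (L) => //=; rewrite ?mulr0 ?rmorphM.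
by rewrite (bcum_blocks_vanish _ lu) // mul0r polyC0 mul0r if_same.
Qed.

End Identities.

(** * The conditional expectation [EpsiX] *)

Lemma enum_set_ordS m (S : {set 'I_m.+1}) :
  [seq val i | i <- enum S] =
  nseq (ord0 \in S) 0%N ++ [seq (val i).+1 | i <- enum (lift ord0 @^-1: S)].
Proof.
rewrite {1}/enum_mem -enumT enum_ordSl /= filter_map.
set F := filter _ _; have -> : F = enum (lift ord0 @^-1: S).
  rewrite /F {2}/enum_mem -enumT; apply: eq_filter => i.
  by rewrite /= inE.
by case: (ord0 \in S); rewrite /= -map_comp.
Qed.

(** Deciding first whether 0 belongs to the subset turns the sum over cut sets in [EpsiX] into a
    recursion. *)
Lemma big_set_ordS (V : nmodType) m (G : seq nat -> V) :
  \sum_(S : {set 'I_m.+1}) G [seq val i | i <- enum S] =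
  \sum_(S : {set 'I_m}) G [seq (val i).+1 | i <- enum S] +
  \sum_(S : {set 'I_m}) G (0%N :: [seq (val i).+1 | i <- enum S]).
Proof.
under eq_bigr => S _ do rewrite enum_set_ordS.
pose K (b : bool) (S : {set 'I_m}) := G (nseq b 0%N ++ [seq (val i).+1 | i <- enum S]).
pose h (p : bool * {set 'I_m}) : {set 'I_m.+1} :=
  [set i | if unlift ord0 i is Some j then j \in p.2 else p.1].
rewrite (reindex h) /=; last first.
  exists (fun S : {set 'I_m.+1} => (ord0 \in S, lift ord0 @^-1: S)) => [[b S]|S] _.
    congr (_, _); first by rewrite inE unlift_none.
    by apply/setP=> i; rewrite !inE liftK.
  by apply/setP=> i; rewrite inE /=; case: unliftP => [j|] ->; rewrite ?inE.
rewrite addrC -[RHS](big_bool _ (fun b => \sum_(S : {set 'I_m}) K b S)).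
rewrite (pair_bigA _ K) /=; apply: eq_bigr => -[b S] _ /=; congr G.
congr (nseq _ _ ++ _); first by rewrite inE unlift_none.
by apply: congr1; apply: eq_enum => i; rewrite !inE liftK.
Qed.

Section Epsi.
Variables (C : numClosedFieldType) (psi : word -> C).

(* [acc] is the part of the current cumulant already read. *)
Fixpoint segsum (acc : seq word) (pr : seq (word * word)) : {poly C} :=
  if pr is (y, x) :: pr' then
    bcum psi (acc ++ [:: y]) *: 'X^(size x) *
      (if pr' is [::] then 1 else segsum [::] pr')
    + segsum (acc ++ [:: y; x]) pr'
  else 0.

Definition segtop pr := if pr is [::] then 1 else segsum [::] pr.

Fixpoint chain (g : nat -> nat -> {poly C}) a l :=
  if l is b :: l' then g a b * chain g b l' else 1.

Lemma chainE (h : nat -> nat -> C) (d : nat -> nat) a l :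
  (\prod_(ab <- zip (a :: l) l) h ab.1 ab.2) *: 'X^(\sum_(b <- l) d b) =
  chain (fun a b => h a b *: 'X^(d b)) a l.
Proof.
elim: l a => [|b l IHl] a /=; first by rewrite !big_nil scale1r expr0.
rewrite -IHl !big_cons -scalerAl -scalerAr -exprD scalerA.
by [].
Qed.

(** Here [a] is the last cut made and [c] the number of pairs read, so pairs a + 1 to c are in the
    accumulator. The induction decides whether c + 1 is a cut; the end c + m + 1 always is one. *)
Lemma big_subsets_segsum (pr : seq (word * word)) a c m :
  let Y k := (nth ([::], [::]) pr k.-1).1 in
  let X k := (nth ([::], [::]) pr k.-1).2 in
  let acc a b := flatten [seq [:: Y k; X k] | k <- iota a.+1 (b - a)] in
  let g a b := bcum psi (flatten [seq [:: Y k; X k] | k <- iota a.+1 (b - a).-1]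
                 ++ [:: Y b]) *: 'X^(size (X b)) in
  (a <= c)%N -> size pr = (c + m).+1 ->
  \sum_(S : {set 'I_m}) chain g a (rcons [seq (c + val i).+1 | i <- enum S] (c + m).+1)
  = segsum (acc a c) (drop c pr).
Proof.
move=> Y X acc g; elim: m a c => [|m IHm] a c leac szpr.
  rewrite (big_pred1 set0) => [|S]; last by apply/esym/eqP; apply/setP => -[].
  rewrite addn0 in szpr *; rewrite (drop_nth ([::], [::])) ?szpr //.
  rewrite drop_oversize ?szpr // enum_set0 /= /g /acc subSn //=.
  by rewrite /X /Y /=; case: nth => y x; rewrite addr0.
have szc : (c < size pr)%N by rewrite szpr ltnS leq_addr.
rewrite (drop_nth ([::], [::])) //.
have -> : segsum (acc a c) (nth ([::], [::]) pr c :: drop c.+1 pr) =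
    g a c.+1 * segsum [::] (drop c.+1 pr) + segsum (acc a c.+1) (drop c.+1 pr).
  have e : drop c.+1 pr <> [::].
    by move=> /(congr1 size); rewrite size_drop szpr subSS addKn.
  rewrite /g /acc subSn // -pred_Sn -(addn1 (c - a)) iotaD map_cat flatten_cat.
  rewrite addSn subnKC // /X /Y /=; case: nth => y x /=.
  by case: (drop c.+1 pr) e.
pose G s := chain g a (rcons [seq (c + i)%N.+1 | i <- s] (c + m.+1).+1).
transitivity (\sum_(S : {set 'I_m.+1}) G [seq val i | i <- enum S]).
  by apply: eq_bigr => S _; rewrite /G -map_comp.
rewrite big_set_ordS addrC; congr (_ + _).
  rewrite -[RHS]/(g a c.+1 * segsum [::] _).
  rewrite -[[::] in RHS]/(flatten [seq [:: Y k; X k] | k <- iota c.+2 0]).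
  rewrite -[0%N in RHS](subnn c.+1) -(IHm c.+1 c.+1) // ?addSnnS // mulr_sumr.
  apply: eq_bigr => S _; rewrite /G /= addn0 -map_comp -addSnnS; congr (_ * chain _ _ (rcons _ _)).
  by apply: eq_map => i /=; rewrite addSnnS.
rewrite -(IHm a c.+1) ?addSnnS // 1?leqW //.
apply: eq_bigr => S _; rewrite /G -map_comp -addSnnS; congr (chain _ _ (rcons _ _)).
by apply: eq_map => i /=; rewrite addSnnS.
Qed.

(** The value of E^psi_X on a word with blocks [bs], empty or starting with an X-block. *)
Definition tailE (bs : seq word) : {poly C} :=
  if bs is x :: bs' then 'X^(size x) * segtop (pairs bs') else 1.

(** The current cumulant must end with a Y-block, hence take an odd number of further blocks. *)
Lemma segsum_splits acc bs : segsum acc (pairs bs) =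
  \sum_(p <- splits bs | odd (size p.1)) bcum psi (acc ++ p.1) *: tailE p.2.
Proof.
have [m] := ubnP (size bs); elim: m acc bs => // m IHm acc [|y [|x bs]] szm.
- by rewrite big_cons big_nil.
- by rewrite !big_cons big_nil /= !addr0 expr0 mulr1.
rewrite /= !big_cons !big_map /= -scalerAl; congr (_ *: _ + _).
rewrite IHm; last exact: ltnW.
by apply: eq_big => p; rewrite ?negbK -?catA.
Qed.

Definition leadX (w : word) := if w is true :: _ then head [::] (blocks w) else [::].
Definition restY (w : word) := if w is true :: _ then behead (blocks w) else blocks w.

Lemma EpsiXE w : EpsiX psi w = 'X^(size (leadX w)) * segtop (pairs (restY w)).
Proof.
rewrite /EpsiX -/(leadX w) -/(restY w).
have fl : leadX w ++ flatten (restY w) = w.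
  rewrite -{3}(flatten_blocks w) /leadX /restY; case: (w) => [|[] w'] //.
  by have [bl [bs ->]] := blocks_head true w'.
case: eqP => [/size0nil p0|/eqP].
  rewrite p0 mulr1 -{1}fl size_cat.
  by case: (restY w) p0 => [|y [|x bs]] //= _; rewrite addn0.
set pr := pairs _; case e : (size pr) => [//|n] _ /=.
have <- : segsum [::] pr = segtop pr by case: (pr) e.
have := @big_subsets_segsum pr 0 0 n (leq0n _) e; rewrite /= drop0 => <-.
rewrite mulr_sumr; apply: eq_bigr => S _.
rewrite -chainE -scalerAr -exprD big_rcons big_map /= addnA.
by [].
Qed.

Lemma EpsiX_nil : EpsiX psi [::] = 1.
Proof. by rewrite EpsiXE mul1r. Qed.

Lemma EpsiX_X w : EpsiX psi (true :: w) = 'X * EpsiX psi w.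
Proof.
rewrite !EpsiXE /leadX /restY blocks_cons.
case: w => [|[] w]; first by rewrite -[blocks [::]]/[::] /= mul1r.
  have [bl [bs ->]] := blocks_head true w.
  by rewrite /= exprS mulrA.
have [bl [bs ->]] := blocks_head false w.
by rewrite /= expr0 mul1r.
Qed.

Lemma EpsiX_pure w : all (pred1 true) w -> EpsiX psi w = 'X^(size w).
Proof.
elim: w => [_|b w IHw]; first by rewrite EpsiX_nil.
by case/andP=> /eqP-> /IHw; rewrite EpsiX_X exprS => ->.
Qed.

Lemma tailE_blocks v : head true v = true -> tailE (blocks v) = EpsiX psi v.
Proof.
case: v => [_|b v /= ->]; first by rewrite EpsiX_nil.
rewrite EpsiXE /leadX /restY; have [bl [bs ->]] := blocks_head true v.
by [].
Qed.

(** Blocks alternate; this matches the parity in [segsum_splits] with the end condition of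
    [betaB]. *)
Lemma odd_size_blocks b u : odd (size (blocks (b :: u))) = (last b u == b).
Proof.
elim: u b => [|c u IHu] b; first by rewrite /= eqxx.
rewrite blocks_cons; have := IHu c; have [bl [bs ->]] := blocks_head c u.
rewrite /=; have [<-|nbc] //= := eqVneq c b.
by move=> ->; move: nbc; case: (last c u); case: (c); case: (b).
Qed.

Lemma EpsiX_Y w : startsWith false (EpsiX psi) w =
  conv (positivePart (cst (betaB false psi)))
       (unitOr (startsWith true (EpsiX psi))) w.
Proof.
rewrite {1}/startsWith /conv; case: eqP => [hw|hw]; last first.
  rewrite big_seq big1 // => -[[|b u] v] /mem_splits /= e; first by rewrite mul0r.
  by rewrite /cst /betaB /= -e in hw *; case: eqP => // _; rewrite mul0r.
case: w hw => [//|b w] /= hw; rewrite hw {b hw}.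
rewrite EpsiXE mul1r /restY.
transitivity (segsum [::] (pairs (blocks (false :: w)))).
  have [bl [bs ->]] := blocks_head false w; by case: bs.
rewrite segsum_splits big_mkcond -big_splits_blocks big_mkcond.
rewrite big_seq [RHS]big_seq; apply: eq_bigr => -[[|b u] v] /mem_splits e.
  by rewrite mul0r.
case: e => -> _; rewrite [odd _]odd_size_blocks /= /cst /betaB /boundary /=.
have [->|_] := eqVneq (last false u) false; last by rewrite polyC0 mul0r if_same.
rewrite -mul_polyC; case: v => [|[] v]; rewrite /unitOr /startsWith /=.
- by rewrite addr0.
- by rewrite add0r tailE_blocks.
by rewrite addr0 mulr0.
Qed.

(** Its series is the single term zAX. *)
Definition serX : word -> {poly C} := fun w => if w == [:: true] then 'X else 0.

Lemma EpsiX_startsX w : startsWith true (EpsiX psi) w = conv serX (EpsiX psi) w.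
Proof.
case: w => [|b w]; rewrite /conv /=; first by rewrite big_seq1 mul0r.
rewrite big_cons mul0r add0r big_map.
have -> : splits w = ([::], w) :: behead (splits w) by case: w.
rewrite big_cons big_seq big1 /= ?addr0 => [|p].
  by rewrite /startsWith /serX /=; case: (b); rewrite ?EpsiX_X ?mul0r.
case: w => //= c w /mapP[q _ ->] /=; by rewrite /serX eqseq_cons andbF mul0r.
Qed.

End Epsi.

(** * The arrow expectation and the series identity *)

Section Arrow.
Variables (C : numClosedFieldType) (phi psi : word -> C).
Implicit Types f g : word -> {poly C}.

Lemma Earrow_fuelE n w : (size w <= n)%N ->
  Earrow_fuel phi psi n w = Earrow phi psi w.
Proof.
suff E : forall n n' w, (size w <= n)%N -> (size w <= n')%N ->
    Earrow_fuel phi psi n w = Earrow_fuel phi psi n' w by move=> le; apply: E.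
move=> {n w}; elim=> [|n IHn] [|n'] w.
- by [].
- by rewrite leqn0 => /nilP->.
- by move=> _; rewrite leqn0 => /nilP->.
move=> len len' /=; do 2!case: ifP => // _.
have tail i : (0 < i)%N -> (i < size w)%N ->
    Earrow_fuel phi psi n (drop i w) = Earrow_fuel phi psi n' (drop i w).
  move=> i0 iw; have lt : (size (drop i w) < size w)%N.
    by rewrite size_drop ltn_subrL i0 (leq_trans _ iw).
  by apply: IHn; rewrite -ltnS; [apply: leq_trans len|apply: leq_trans len'].
(* Index 0 is excluded, as the letter there is not the one cut at; so every recursive call is on a
   strictly shorter word. *)
case: ifP => /eqP hw; congr (_ + _); apply: eq_bigr => -[[|i] ltiw] /= ni;
  rewrite ?tail //; case: (w) hw ltiw ni => //= b w' hb _; rewrite ?hb //.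
by case: (b) hb.
Qed.

Lemma conv_unitOr f g w : conv f (unitOr g) w = f w + conv f g w.
Proof.
rewrite /conv /unitOr; under eq_bigr => p _ do rewrite mulrDr.
rewrite big_split /=; congr (_ + _).
elim: w f => [|b w IHw] f; first by rewrite big_seq1 mulr1.
by rewrite /= big_cons big_map (IHw (fun u => f (b :: u))) mulr0 add0r.
Qed.

(** Indexing cuts by the letter [L] after them gives the coproduct as coded in [Earrow_fuel]. The
    cut at the end drops out because the default letter is [~~ L]. *)
Lemma conv_startsWith L f g w :
  conv f (startsWith L g) w =
  \sum_(i < size w | nth (~~ L) w i == L) f (take i w) * g (drop i w).
Proof.
rewrite /conv splitsE big_map -[iota _ _]/(index_iota 0 (size w).+1).
rewrite big_mkord big_ord_recr /= drop_size /startsWith /=.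
have -> : (~~ L == L) = false by case: (L).
rewrite mulr0 addr0 [RHS]big_mkcond; apply: eq_bigr => i _.
rewrite -[head _ _]nth0 nth_drop addn0.
by case: ifP => // _; rewrite mulr0.
Qed.

Lemma blocks_pure b w : all (pred1 b) w -> blocks (b :: w) = [:: b :: w].
Proof.
elim: w => // c w IHw /= /andP[/eqP-> /IHw e].
by rewrite blocks_cons e /= eqxx.
Qed.

Lemma betaB_pure theta b w : all (pred1 b) w -> betaB b theta (b :: w) = theta (b :: w) :> C.
Proof.
move=> aw; rewrite /betaB blocks_pure // [head _ _]/= eqxx.
have -> : last (~~ b) (b :: w) = b.
  by elim: w aw => //= c w IHw /andP[/eqP-> /IHw].
by rewrite eqxx /= /bcum /= big_geq // subr0 cats0.
Qed.

(** The separate clause for pure words agrees with the general rule: the sum is empty and a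
    one-argument cumulant is [phi] itself. *)
Lemma Earrow_false w : let w' := false :: w in
  Earrow phi psi w' = (betaB false phi w')%:P +
  \sum_(i < size w' | nth false w' i == true)
     betaB false phi (take i w') *: Earrow phi psi (drop i w').
Proof.
move=> w'; rewrite {1}/Earrow -[size w']/(size w).+1.
rewrite [LHS]/=; case: ifPn => [aw|_].
  rewrite (betaB_pure phi aw) big1 ?addr0 // => i.
  have /allP aw' : all (pred1 false) w' by [].
  by rewrite (eqP (aw' _ (mem_nth false (s := w') (ltn_ord i)))).
congr (_ + _); apply: eq_bigr => -[[|i] //= lti] _.
rewrite Earrow_fuelE // size_drop; exact: leq_subr.
Qed.

Lemma Earrow_true w : let w' := true :: w in
  Earrow phi psi w' = EpsiX psi w' +
  \sum_(i < size w' | nth true w' i == false)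
     betaB true phi (take i w') *: (Earrow phi psi (drop i w') - EpsiX psi (drop i w')).
Proof.
move=> w'; rewrite {1}/Earrow -[size w']/(size w).+1.
rewrite [LHS]/=; case: ifPn => [aw|_].
  rewrite (@EpsiX_pure _ psi w') // big1 ?addr0 // => i.
  have /allP aw' : all (pred1 true) w' by [].
  by rewrite (eqP (aw' _ (mem_nth true (s := w') (ltn_ord i)))).
congr (_ + _); apply: eq_bigr => -[[|i] //= lti] _.
rewrite Earrow_fuelE // size_drop; exact: leq_subr.
Qed.

Lemma Earrow_Y w : startsWith false (Earrow phi psi) w =
  conv (positivePart (cst (betaB false phi)))
       (unitOr (startsWith true (Earrow phi psi))) w.
Proof.
rewrite conv_unitOr conv_startsWith; case: w => [|[] w].
- by rewrite big_ord0 addr0 /startsWith.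
- rewrite /startsWith /= /cst /betaB /= add0r big1 // => -[[|i] /= _] _;
    by rewrite mul0r.
rewrite [LHS]Earrow_false; congr (_ + _); apply: eq_bigr => -[[|i] //= lti] _.
by rewrite -mul_polyC.
Qed.

Lemma Earrow_X w :
  startsWith true (fun w => Earrow phi psi w - EpsiX psi w) w =
  conv (positivePart (cst (betaB true phi)))
       (startsWith false (fun w => Earrow phi psi w - EpsiX psi w)) w.
Proof.
rewrite conv_startsWith; case: w => [|[] w].
- by rewrite big_ord0 /startsWith.
- rewrite [LHS]/startsWith [LHS]/= Earrow_true addrC addKr.
  by apply: eq_bigr => -[[|i] //= lti] _; rewrite -mul_polyC.
rewrite /startsWith /= /cst /betaB /= big1 // => -[[|i] /= _] _;
  by rewrite mul0r.
Qed.

End Arrow.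

(** * Identities between cumulant and moment series *)

Section BooleanSeries.
Variables (C : numClosedFieldType) (phi psi : word -> C).
Hypotheses (phi1 : phi [::] = 1) (psi1 : psi [::] = 1).
Hypothesis hcfree : c_free phi psi.
Variables (N : nat) (A B : 'M[C]_N).
Implicit Types (L : bool) (f : word -> {poly C}).
Local Notation serAB := (ser A B).

Lemma ser_unitOr f : serAB (unitOr f) = 1 + serAB f.
Proof. by rewrite -(ser1 A B) serD. Qed.

Lemma ser_startsWith L f : f [::] = 1 ->
  serAB f = 1 + serAB (startsWith L f) + serAB (startsWith (~~ L) f).
Proof.
move=> f1; rewrite -(ser1 A B) !serD; apply: eq_ser => -[|b w].
  by rewrite f1 /startsWith; case: (L); rewrite !addr0.
by rewrite /startsWith /= add0r; case: (b); case: (L); rewrite /= ?addr0 ?add0r.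
Qed.

Lemma startsWithB L f g w :
  startsWith L f w - startsWith L g w = startsWith L (fun w => f w - g w) w.
Proof. by rewrite /startsWith; case: ifP => // _; rewrite subr0. Qed.

Definition dser L theta := serAB (positivePart (cst (betaD L theta))).
Definition bser L theta := serAB (positivePart (cst (betaB L theta))).

(** Multiplied by [1 + m'], both sides equal [m]; and [1 + m'] is invertible, having constant term
    1. *)
Lemma bserE L : bser L phi = dser L phi * (1 + bser L phi).
Proof.
set m := serAB (startsWith L (cst phi)); set m' := serAB (startsWith (~~ L) (cst phi)).
have phiE : serAB (cst phi) = 1 + m + m' by apply: ser_startsWith; rewrite /cst phi1.
have md : m = dser L phi * (1 + m + m').
  by rewrite -phiE serM; apply: eq_ser => w; apply: startsWith_letters psi1 hcfree _ _.
have mb : m = bser L phi * (1 + m').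
  by rewrite -ser_unitOr serM; apply: eq_ser => w; apply: startsWith_blocks psi1 hcfree _ _.
have m1 : (1 + m') 0%N = 1.
  by rewrite fpsD /m' /serAB big_seq1 /startsWith /=; case: (L); rewrite /= scale0r addr0.
have e : bser L phi * (1 + m') = dser L phi * (1 + bser L phi) * (1 + m').
  by rewrite -mulrA [(1 + bser L phi) * _]mulrDl mul1r -mb -addrA (addrC m') addrA -md.
by rewrite -[LHS]mulr1 -(psinvfV m1) mulrA e -!mulrA psinvfV // mulr1.
Qed.

End BooleanSeries.

Section Series.
Variables (C : numClosedFieldType) (phi psi : word -> C).
Hypotheses (phi1 : phi [::] = 1) (psi1 : psi [::] = 1).
Hypothesis hcfree : c_free phi psi.
Variables (N : nat) (A B : 'M[C]_N).
Local Notation serAB := (ser A B).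
Local Notation dserAB := (dser A B).
Local Notation bserAB := (bser A B).

Lemma Earrow_nil : Earrow phi psi [::] = 1.
Proof. by []. Qed.

Lemma EpsiX_series :
  serAB (startsWith true (EpsiX psi)) = serAB (serX C) * serAB (EpsiX psi) /\
  serAB (startsWith false (EpsiX psi)) = dserAB false psi * serAB (EpsiX psi).
Proof.
have eX : serAB (startsWith true (EpsiX psi)) = serAB (serX C) * serAB (EpsiX psi).
  by rewrite serM; apply: eq_ser => w; apply: EpsiX_startsX.
have eY : serAB (startsWith false (EpsiX psi)) =
    bserAB false psi * (1 + serAB (startsWith true (EpsiX psi))).
  by rewrite -ser_unitOr serM; apply: eq_ser => w; apply: EpsiX_Y.
have eG := ser_startsWith A B true (EpsiX_nil psi).
have eb := bserE psi1 psi1 (c_free_diag hcfree) A B false.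
split=> //; rewrite eG [serAB (startsWith (~~ true) _)]eY.
by rewrite {1}eb -mulrA mulrDl mul1r.
Qed.

Lemma Earrow_series :
  let G := serAB (EpsiX psi) in let E := serAB (Earrow phi psi) in
  (1 - dserAB true phi - dserAB false phi) * E = (1 - dserAB true phi - dserAB false psi) * G.
Proof.
move=> G E; have [eX eY] := EpsiX_series.
have eG : G = 1 + _ + _ := ser_startsWith A B true (EpsiX_nil psi).
have eE : E = 1 + _ + _ := ser_startsWith A B true Earrow_nil.
set eX' := serAB (startsWith true (EpsiX psi)) in eX eG.
set eY' := serAB (startsWith false (EpsiX psi)) in eY eG.
set EX := serAB (startsWith true (Earrow phi psi)) in eE.
set EY := serAB (startsWith false (Earrow phi psi)) in eE.
have EYE : EY = dserAB false phi * E.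
  have h : EY = bserAB false phi * (1 + EX).
    by rewrite -ser_unitOr serM; apply: eq_ser => w; apply: Earrow_Y.
  rewrite h {1}(bserE phi1 psi1 hcfree A B false) -mulrA; congr (_ * _).
  by rewrite mulrDl mul1r -h eE.
have EXE : EX - eX' = dserAB true phi * (E - G).
  have h : EX - eX' = bserAB true phi * (EY - eY').
    rewrite !serB serM; apply: eq_ser => w.
    by rewrite (funext (startsWithB false _ _)) -Earrow_X -startsWithB.
  rewrite h {1}(bserE phi1 psi1 hcfree A B true) -mulrA; congr (_ * _).
  (* Since b_X (E_Y - G_Y) = E_X - G_X, the factor 1 + b_X turns E_Y - G_Y into E - G. *)
  rewrite mulrDl mul1r -h eE eG.
  by rewrite opprD [RHS]addrACA opprD [1 + EX + _]addrACA subrr add0r addrC.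
rewrite !mulrBl !mul1r -EYE -eY.
have -> : dserAB true phi * E = EX - eX' + dserAB true phi * G.
  by rewrite EXE mulrBr subrK.
move: (dserAB true phi * G) => t.
(* Both sides reduce to [1 + eX' - t]. *)
rewrite eE eG -/EX -/EY -/eX' -/eY'.
rewrite [LHS]addrAC addrK [RHS]addrAC addrK opprD opprB addrA addrACA subrr addr0.
by [].
Qed.

Lemma liftmZ (a : C) (M : 'M[C]_N) : liftm (a *: M) = a%:P *: liftm M.
Proof. exact: map_mxZ. Qed.

Lemma liftm_sum (I : Type) (r : seq I) (F : I -> 'M[C]_N) :
  liftm (\sum_(i <- r) F i) = \sum_(i <- r) liftm (F i).
Proof. exact: raddf_sum. Qed.

(** This is d_X = zA F_X and d_Y = zB F_Y: contributing words start with [L], whose matrix comes out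
    on the left with one power of z. *)
Lemma dserS L theta m :
  dserAB L theta m.+1 = liftm (if L then A else B) * liftm (Fser L theta A B m).
Proof.
have -> : Fser L theta A B m = \sum_(w <- words m) betaD L theta (L :: w) *: Cw A B w.
  exact: (big_words m (fun w => betaD L theta (L :: w) *: Cw A B w)).
rewrite liftm_sum mulr_sumr /dser /ser big_cat !big_map /=.
have CwS b w : liftm (Cw A B (b :: w)) = liftm (if b then A else B) * liftm (Cw A B w).
  by rewrite /Cw big_cons liftmM.
have E1 : \sum_(w <- words m) positivePart (cst (betaD L theta)) (~~ L :: w) *:
    liftm (Cw A B (~~ L :: w)) = 0.
  by rewrite big1 // => w _; rewrite /= /cst /betaD /=; case: (L); rewrite scale0r.
have E2 : \sum_(w <- words m) positivePart (cst (betaD L theta)) (L :: w) *: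
    liftm (Cw A B (L :: w)) =
    \sum_(w <- words m) liftm (if L then A else B) *
      liftm (betaD L theta (L :: w) *: Cw A B w).
  apply: eq_bigr => w _; rewrite /= /cst CwS liftmZ.
  by rewrite -!mulmxE scalemxAr.
by case: (L) E1 E2 => /= -> ->; rewrite ?addr0 ?add0r.
Qed.

Lemma dser0 L theta : dserAB L theta 0%N = 0.
Proof. by rewrite /dser /ser big_seq1 scale0r. Qed.

Lemma IminusE theta1 theta2 :
  Iminus A B (Fser true theta1 A B) (Fser false theta2 A B) =
  1 - dserAB true theta1 - dserAB false theta2.
Proof.
apply/funext => -[|m]; rewrite !fpsD !fpsN fps1E; first by rewrite !dser0 !subr0.
by rewrite !dserS /= sub0r -opprD.
Qed.

Lemma serXS m : serAB (serX C) m.+1 = if m == 0%N then liftm A * ('X)%:M else 0.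
Proof.
rewrite /ser big_cat !big_map /= [X in _ + X]big1 ?addr0 => [|w _]; last first.
  by rewrite /serX eqseq_cons scale0r.
case: m => [|m] /=.
  rewrite big_seq1 /serX eqxx -mulmxE mul_mx_scalar.
  by rewrite /Cw big_seq1.
by rewrite big_cat /= !big_map !big1 ?addr0 // => w _; rewrite /serX eqseq_cons scale0r.
Qed.

Lemma IminusXE theta :
  IminusX A B (Fser false theta A B) = 1 - serAB (serX C) - dserAB false theta.
Proof.
apply/funext => -[|m]; rewrite !fpsD !fpsN fps1E.
  by rewrite dser0 /ser big_seq1 /serX scale0r !subr0.
by rewrite dserS serXS /= sub0r -opprD.
Qed.

Lemma EpsiX_inverse :
  (1 - serAB (serX C) - dserAB false psi) * serAB (EpsiX psi) = 1.
Proof.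
have [eX eY] := EpsiX_series.
rewrite !mulrBl mul1r -eX -eY {1}(ser_startsWith A B true (EpsiX_nil psi)).
by rewrite addrAC addrK addrK.
Qed.

End Series.

Theorem theorem6 (C : numClosedFieldType) (N : nat) (phi psi : word -> C)
  (phi1 : phi [::] = 1) (psi1 : psi [::] = 1)
  (hcfree : c_free phi psi) (A B : 'M[C]_N) :
  let FY := Fser false psi A B in
  let FXphi := Fser true phi A B in
  let FYphi := Fser false phi A B in
  EPsi phi psi A B =
  psmul (psmul (psinv (Iminus A B FXphi FYphi)) (Iminus A B FXphi FY))
        (psinv (IminusX A B FY)).
Proof.
move=> FY FXphi FYphi.
have -> : EPsi phi psi A B = ser A B (Earrow phi psi).
  apply/funext => n.
  exact: (big_words n (fun w => Earrow phi psi w *: liftm (Cw A B w))).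
rewrite IminusXE !IminusE !fpsME.
set F1 := 1 - _ - dser A B false phi; set F2 := 1 - dser _ _ _ _ - _; set F3 := 1 - _ - _.
have F10 : F1 0%N = 1 by rewrite /F1 -IminusE.
have F30 : F3 0%N = 1 by rewrite /F3 -IminusXE.
(* E^psi_X[Psi] is a right inverse of [F3] and [psinv F3] a left one, so they agree. *)
have GE : ser A B (EpsiX psi) = psinv F3.
  rewrite -[LHS]mul1r -(psinvVf F30) -mulrA.
  by rewrite (EpsiX_inverse psi1 hcfree) mulr1.
rewrite -GE -mulrA -(Earrow_series phi1 psi1 hcfree).
by rewrite mulrA psinvVf // mul1r.
Qed.
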